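(* Let $\mathbb{X}=(S_C,S_Q,I,\delta)$ be the counterfactual generation problem (CFG) constructed from a run of the algorithm $\mathrm{get\_path}$ on inputs $I$, $S$, $C$, $Q$, $A$, and suppose that the run succeeds (returns a list). Let $P$ be the corresponding candidate path. Then $P$ is a solution path for $\mathbb{X}$. That is, writing $P=s_0,\dots,s_m$ with $m\ge 0$ and letting $G$ be the goal set of $\mathbb{X}$: $s_0=I$; $s_m\in G$; $s_j\in S_C$ for all $j\in\{0,\dots,m\}$; $s_0,\dots,s_{m-1}\notin G$; and $s_{i+1}\in\delta(s_i)$ for all $i\in\{0,\dots,m-1\}$.
   Context: States and rules. Let $D_1,\dots,D_n$ be the domains of features $1,\dots,n$. The state space is $S=\{(V_1,\dots,V_n)\mid V_i\in D_i \text{ for each } i\}$. A rule is a predicate on states with values TRUE/FALSE; a state $s$ satisfies a rule $r$ iff $r(s)$ is TRUE. $C$ is a set of rules (causal rules) and $Q$ is a set of rules (decision rules). The causally consistent state space is $S_C=\{s\in S\mid s \text{ satisfies all rules in } C\}$. The decision consistent state space is $S_Q=\{s\in S_C\mid s\text{ satisfies at least one rule in }Q\}$. The initial state $I$ is an element of $S_C$. Actions. An action is a function $a:S\to S$ with $a(s)\neq s$ for every $s$. $A$ is a set of actions, each of which is a direct action ($a(s)$ is obtained from $s$ by altering exactly one feature value, for every $s$) or a causal action ($a(s)\in S_C$ for every $s$). CFG. A counterfactual generation problem is a tuple $(S_C,S_Q,I,\delta)$ with $I\in S_C$ and a transition function $\delta:S_C\to\mathcal P(S_C)$. Its goal set is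 $G=\{s\in S_C\mid s\notin S_Q\}$. A solution path is a sequence $s_0,\dots,s_m$ of elements of $S_C$ with $s_0=I$, $s_m\in G$, $s_0,\dots,s_{m-1}\notin G$, and $s_{i+1}\in\delta(s_i)$ for $0\le i\le m-1$. CFG constructed from a run. For a run of the algorithm $\mathrm{get\_path}$ on inputs $I,S,C,Q,A$, the constructed CFG is $(S_C,S_Q,I,\delta)$, where $S_C=\{s\in S\mid s \text{ satisfies all rules in } C\}$, $S_Q=\{s\in S_C\mid s\text{ satisfies at least one rule in }Q\}$, $I\in S_C$ is the input initial state, and $\delta(s)=\{s'\in S_C\mid s'=\sigma(s,a) \text{ for some } a\in A\}$, where $\sigma(s,a)=a(s)$ if $a(s)\in S_C$, and otherwise $\sigma(s,a)=\sigma(a(s),a')$ for some choice of $a'\in A$. Explicitly, $s'\in\delta(s)$ iff there are $k\ge1$ and $a_1,\dots,a_k\in A$ such that, with $t_0=s$ and $t_j=a_j(t_{j-1})$, one has $t_1,\dots,t_{k-1}\notin S_C$ and $t_k=s'\in S_C$. Algorithms. $\mathit{visited}$ is a list of pairs (state, list of actions). ''pop'' removes and returns the last element of a list. Lists are passed by value. An action $a$ is called admissible at $(s,\mathit{taken})$ with respect to $\mathit{visited}$ if $a(s)$ is not the state component of any pair in $\mathit{visited}$ and $a$ does not occur in $\mathit{taken}$. Whenever an action is to be selected, any one satisfying the stated requirement may be chosen (nondeterministically). - $\mathrm{is\_counterfactual}(s,C,Q)$: returns TRUE if $s$ satisfies all rules in $C$ and no rule in $Q$; otherwise returns FALSE.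 - $\mathrm{update}(s,\mathit{visited},\mathit{taken},a)$: append $a$ to $\mathit{taken}$; append $(s,\mathit{taken})$ to $\mathit{visited}$; set $s:=a(s)$; return $(s,[\,])$ and $\mathit{visited}$. - $\mathrm{make\_consistent}(s,\mathit{taken},\mathit{visited},C,A)$: while $s$ does not satisfy all rules in $C$: if there is an admissible causal action in $A$ at $(s,\mathit{taken})$, select one, $a$, and set $(s,\mathit{taken}),\mathit{visited}:=\mathrm{update}(s,\mathit{visited},\mathit{taken},a)$; otherwise, if there is an admissible direct action in $A$, select one, $a$, and do the same update with it; otherwise (backtracking), if $\mathit{visited}$ is empty exit the whole algorithm with failure, else set $(s,\mathit{taken}):=\mathrm{pop}(\mathit{visited})$. After the loop, return $(s,\mathit{taken})$ and $\mathit{visited}$. - $\mathrm{intervene}(\mathit{visited},C,A)$: set $(s,\mathit{taken}):=\mathrm{pop}(\mathit{visited})$. If there is an admissible action in $A$ at $(s,\mathit{taken})$ (with respect to the remaining list), select one, $a$, and set $(s,\mathit{taken}),\mathit{visited}:=\mathrm{update}(s,\mathit{visited},\mathit{taken},a)$. Otherwise (backtracking), if $\mathit{visited}$ is empty exit the whole algorithm with failure, else set $(s,\mathit{taken}):=\mathrm{pop}(\mathit{visited})$. Then set $(s,\mathit{taken}),\mathit{visited}:=\mathrm{make\_consistent}(s,\mathit{taken},\mathit{visited},C,A)$, append $(s,\mathit{taken})$ to $\mathit{visited}$, and return $\mathit{visited}$. - $\mathrm{get\_path}(I,S,C,Q,A)$: set $\mathit{visited}:=[(I,[\,])]$. While $\mathrm{is\_counterfactual}(s,C,Q)$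 is FALSE, where $s$ is the state component of the last element of $\mathit{visited}$, set $\mathit{visited}:=\mathrm{intervene}(\mathit{visited},C,A)$. Return $\mathit{visited}$. Candidate path. If a run of $\mathrm{get\_path}$ succeeds and returns the list $r$, let $r'$ be obtained from $r$ by removing all elements whose state is not in $S_C$. The candidate path is the sequence of the state components of the elements of $r'$, in order; it is written $s_0,\dots,s_m$. *)

(* Defs.v *)
From mathcomp Require Import all_boot boolp classical_sets.
From Stdlib Require List.

Set Implicit Arguments.
Unset Strict Implicit.
Unset Printing Implicit Defensive.

Local Open Scope classical_set_scope.

Section StatesRulesActions.
Variables (n : nat) (D : 'I_n -> Type).

(* The state space S is the whole type [state]. *)
Definition state : Type := forall i : 'I_n, D i.

Definition rule : Type := state -> bool.

Definition causally_consistent (C : set rule) : set state :=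
  [set s | forall r, C r -> r s].

Definition decision_consistent (C Q : set rule) : set state :=
  [set s | causally_consistent C s /\ exists2 r, Q r & r s].

Definition is_action (a : state -> state) : Prop := forall s, a s <> s.

Definition direct_action (a : state -> state) : Prop :=
  forall s, exists! i, a s i <> s i.

Definition causal_action (C : set rule) (a : state -> state) : Prop :=
  forall s, causally_consistent C (a s).

Definition action_set (C : set rule) (A : set (state -> state)) : Prop :=
  forall a, A a -> is_action a /\ (direct_action a \/ causal_action C a).

End StatesRulesActions.

(* The transition function has domain [cfg_SC]: its values at states outside
   [cfg_SC] carry no meaning. *)
Record CFG (T : Type) := MkCFG {
  cfg_SC : set T;
  cfg_SQ : set T;
  cfg_init : T;
  cfg_delta : T -> set T;
  cfg_initP : cfg_SC cfg_init;
  cfg_deltaP : forall s, cfg_SC s -> cfg_delta s `<=` cfg_SC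
}.

Definition goal_set (T : Type) (X : CFG T) : set T :=
  [set s | cfg_SC X s /\ ~ cfg_SQ X s].

(* The sequence s_0, ..., s_m is the list [p] of size m + 1; the default value
   of [nth] is never reached. *)
Definition solution_path (T : Type) (X : CFG T) (p : seq T) : Prop :=
  let m := (size p).-1 in
  let s_ := nth (cfg_init X) p in
  [/\ (0 < size p)%N,
      s_ 0%N = cfg_init X,
      goal_set X (s_ m),
      forall j, (j <= m)%N -> cfg_SC X (s_ j) &
      (forall j, (j < m)%N -> ~ goal_set X (s_ j)) /\
      (forall i, (i < m)%N -> cfg_delta X (s_ i) (s_ i.+1))].

Section ConstructedCFG.
Variables (n : nat) (D : 'I_n -> Type).
Variables (C Q : set (rule D)) (A : set (state D -> state D)).

(* [sigma s a s'] means that s' is a possible value of sigma(s, a), which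
   depends on the choices of the follow-up actions a'. *)
Inductive sigma (s : state D) (a : state D -> state D) : state D -> Prop :=
| sigma_consistent : causally_consistent C (a s) -> sigma s a (a s)
| sigma_continue a' s' : ~ causally_consistent C (a s) -> A a' ->
    sigma (a s) a' s' -> sigma s a s'.

Definition delta (s : state D) : set (state D) :=
  [set s' | causally_consistent C s' /\ exists2 a, A a & sigma s a s'].

Lemma delta_sub s : causally_consistent C s ->
  delta s `<=` causally_consistent C.
Proof. by move=> _ s' []. Qed.

Lemma deltaP (s s' : state D) : delta s s' <->
  exists (k : nat) (a_ : nat -> state D -> state D) (t : nat -> state D),
    [/\ (1 <= k)%N, t 0%N = s /\ t k = s',
        forall j, (j < k)%N -> A (a_ j) /\ t j.+1 = a_ j (t j),
        forall j, (1 <= j < k)%N -> ~ causally_consistent C (t j) &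
        causally_consistent C s'].
Proof.
split=> [[Cs' [a Aa sas']]|].
  elim: {s a s'} sas' Cs' Aa => [s a Cas _ Aa|s a a' s' nCas Aa' _ IH Cs' Aa].
    exists 1%N, (fun=> a), (fun j => if j is 0 then s else a s).
    by split=> // [[]//|[|[]]].
  have [k [a_ [t [k1 [t0 tk] tS tN _]]]] := IH Cs' Aa'.
  exists k.+1, (fun j => if j is i.+1 then a_ i else a),
    (fun j => if j is i.+1 then t i else s).
  split=> // [[|j] ltjk|[|[|j]] // ltjk].
  - by split.
  - exact: tS.
  - by rewrite /= t0.
  - exact: tN.
move=> [k [a_ [t [k1 [t0 tk] tS tN Cs']]]]; split=> //.
elim: k a_ t s k1 t0 tk tS tN => // k IH a_ t s _ t0 tk tS tN.
have [Aa t1] := tS 0%N isT; exists (a_ 0%N) => //.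
case: k => [|k] in IH tk tS tN *.
  by rewrite -tk t1 t0; apply: sigma_consistent; rewrite -t0 -t1 tk.
have [] := IH (fun j => a_ j.+1) (fun j => t j.+1) (t 1%N) isT erefl tk.
- by move=> j; apply: (tS j.+1).
- by move=> j /andP[_ jk]; apply: (tN j.+1).
move=> a' Aa' sa'; rewrite t1 t0 in sa'.
by apply: sigma_continue Aa' sa'; rewrite -t0 -t1; apply: tN.
Qed.

Definition constructed_cfg (s0 : state D) (hs0 : causally_consistent C s0) :
    CFG (state D) :=
  MkCFG (decision_consistent C Q) hs0 delta_sub.

End ConstructedCFG.

(* Exits of a loop with failure, and infinite executions, produce no result. *)
Inductive while_loop (T : Type) (guard : T -> Prop) (body : T -> T -> Prop) :
    T -> T -> Prop :=
| while_exit x : ~ guard x -> while_loop guard body x x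
| while_iter x y z : guard x -> body x y -> while_loop guard body y z ->
    while_loop guard body x z.

Section Algorithms.
Variables (n : nat) (D : 'I_n -> Type).
Variables (C Q : set (rule D)) (A : set (state D -> state D)).

(* A pair (state, list of actions taken). *)
Definition entry : Type := state D * seq (state D -> state D).

(* The current pair (s, taken), together with the list visited. *)
Definition config : Type := entry * seq entry.

Definition admissible (c : config) (a : state D -> state D) : Prop :=
  let: ((s, taken), visited) := c in
  ~ List.In (a s) [seq e.1 | e <- visited] /\ ~ List.In a taken.

Definition admissible_any (c : config) : set (state D -> state D) :=
  [set a | A a /\ admissible c a].

Definition admissible_causal (c : config) : set (state D -> state D) :=
  [set a | [/\ A a, causal_action C a & admissible c a]].

Definition admissible_direct (c : config) : set (state D -> state D) :=
  [set a | [/\ A a, direct_action a & admissible c a]].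

Definition is_counterfactual (s : state D) : Prop :=
  (forall r, C r -> r s) /\ (forall r, Q r -> ~~ r s).

Definition update (c : config) (a : state D -> state D) : config :=
  let: ((s, taken), visited) := c in
  ((a s, [::]), rcons visited (s, rcons taken a)).

(* Backtracking pops the last element [e] of visited; on the empty list it is
   undefined, which is the exit with failure. *)
Inductive backtrack : config -> config -> Prop :=
| backtrack_pop e0 visited e : backtrack (e0, rcons visited e) (e, visited).

Inductive make_consistent_body (c : config) : config -> Prop :=
| mc_causal a : admissible_causal c a -> make_consistent_body c (update c a)
| mc_direct a : ~ (exists b, admissible_causal c b) ->
    admissible_direct c a -> make_consistent_body c (update c a)
| mc_backtrack c' : ~ (exists b, admissible_causal c b) ->
    ~ (exists b, admissible_direct c b) ->
    backtrack c c' -> make_consistent_body c c'.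

Definition make_consistent : config -> config -> Prop :=
  while_loop (fun c => ~ causally_consistent C c.1.1) make_consistent_body.

Inductive intervene_move (c : config) : config -> Prop :=
| im_action a : admissible_any c a -> intervene_move c (update c a)
| im_backtrack c' : ~ (exists b, admissible_any c b) ->
    backtrack c c' -> intervene_move c c'.

Inductive intervene : seq entry -> seq entry -> Prop :=
| intervene_run visited e c e' visited' :
    intervene_move (e, visited) c ->
    make_consistent c (e', visited') ->
    intervene (rcons visited e) (rcons visited' e').

(* [get_path s0 r]: some run from the initial state s0 succeeds and returns r.
   The list visited is never empty, so the default of [last] is irrelevant. *)
Definition get_path (s0 : state D) (r : seq entry) : Prop :=
  while_loop (fun visited => ~ is_counterfactual (last (s0, [::]) visited).1)
    intervene [:: (s0, [::])] r.

Definition candidate_path (r : seq entry) : seq (state D) :=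
  [seq e.1 | e <- r & `[< causally_consistent C e.1 >]].

End Algorithms.

(* Main.v *)
Require Import Defs.
From mathcomp Require Import all_boot boolp classical_sets.

(** The states in [visited], followed by the current state, always form a walk
from I along actions of A: an update extends this walk and a backtracking step
deletes its last state.  All states of the walk but the last are outside the
goal set, because a state is appended to [visited] only while it fails the
guard of [get_path] or of [make_consistent].  Deleting the causally
inconsistent states merges each maximal inconsistent stretch of the walk into
one transition of delta. *)

Lemma while_loop_invariant (T : Type) (guard : T -> Prop)
    (body : T -> T -> Prop) (P : T -> Prop) :
    (forall x y, guard x -> body x y -> P x -> P y) ->
  forall x y, while_loop guard body x y -> P x -> P y /\ ~ guard y.
Proof.
move=> bodyP x y; elim=> {x y} [x|x y z gx bxy _ IH Px]; first by split.
exact/IH/(bodyP _ _ gx bxy).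
Qed.

Section Walks.
Context {n : nat} {D : 'I_n -> Type}.
Variables (C Q : set (rule D)) (A : set (state D -> state D)) (I : state D).
Implicit Types (s : state D) (p w : seq (state D)).

Let consistent s : bool := `[< causally_consistent C s >].
Let step s s' : bool := `[< exists2 a, A a & s' = a s >].
Let transition s s' : bool := `[< delta C A s s' >].
Let nongoal s : bool := `[< ~ is_counterfactual C Q s >].

(** The right-hand side is [goal_set] of the constructed CFG unfolded, so the exit test of
    [get_path] is membership in the goal set. *)
Lemma is_counterfactualP s : is_counterfactual C Q s <->
  causally_consistent C s /\ ~ decision_consistent C Q s.
Proof.
split=> [[Cs nQs]|[Cs nQs]]; first by split=> // -[_ [r /nQs/negP]].
by split=> // r Qr; apply/negP => rs; apply: nQs; split=> //; exists r.
Qed.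

(* The second conjunct handles a start inside an inconsistent stretch, entered
   from [s0] by the action [a]. *)
Lemma path_filter_consistent s p : path step s p ->
  (consistent s -> path transition s (filter consistent p)) /\
  (~~ consistent s -> forall s0 a, A a -> s = a s0 ->
     path transition s0 (filter consistent p)).
Proof.
(* For the induction, the first consistent state [s'] of the rest of the walk is exposed: [sigma]
   then extends backwards along the inconsistent stretch one action at a time. *)
suff H : path step s p ->
    (consistent s -> path transition s (filter consistent p)) /\
    (~~ consistent s -> if filter consistent p is s' :: p' then
       (forall s0 a, A a -> s = a s0 -> sigma C A s0 a s') /\
       path transition s' p' else True).
  move=> /H[Hc Hi]; split=> // ns s0 a Aa sE; move: (Hi ns).
  case Ep: (filter consistent p) => [//|s' p'] /= [sig ->]; rewrite andbT.
  have /asboolP Cs' : consistent s'.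
    have := filter_all consistent p; rewrite Ep => /= /andP[->] //.
  by apply/asboolP; split=> //; exists a => //; apply: sig.
elim: p s => [//|x p IH] s /= /andP[/asboolP[a Aa xE] /IH[IHc IHi]].
case: ifPn => [cx|nx].
  have /asboolP Cx := cx.
  have sig : sigma C A s a x by rewrite xE; apply: sigma_consistent; rewrite -xE.
  split=> [_ /=|/asboolP ns].
    by rewrite IHc // andbT; apply/asboolP; split=> //; exists a.
  split; last exact: IHc.
  by move=> s0 b Ab sE; apply: (sigma_continue (a' := a)); rewrite -?sE.
(* The stretch continues through [x], and [s'] is where it ends. *)
have {IHi} := IHi nx; case Ep: (filter consistent p) => [//|s' p'] [sig pp'].
have /asboolP Cs' : consistent s'.
  have := filter_all consistent p; rewrite Ep => /= /andP[->] //.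
split=> [_ /=|/asboolP ns].
  rewrite pp' andbT; apply/asboolP; split=> //; exists a => //.
  exact: sig.
split=> // s0 b Ab sE; apply: (sigma_continue (a' := a)); rewrite -?sE //.
exact: sig.
Qed.

(** Here [w] stands for the states in visited and [s] for the current state, which may already be a
    goal. *)
Let walk w s := [/\ head I (rcons w s) = I, sorted step (rcons w s) &
  all nongoal w].

Lemma walk_step w s a : A a -> ~ is_counterfactual C Q s -> walk w s ->
  walk (rcons w s) (a s).
Proof.
move=> Aa /asboolP ns [hw sw aw]; split.
- by case: w hw {sw aw}.
- have sa : step s (a s) by apply/asboolP; exists a.
  case: w sw {hw aw} => [|x w] /= sw; first by rewrite sa.
  by rewrite rcons_path last_rcons sw.
- by rewrite all_rcons aw andbT.
Qed.

Lemma walk_pop w s s' : walk (rcons w s) s' -> walk w s.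
Proof.
move=> [hw sw aw]; split.
- by case: w hw {sw aw}.
- by case: w sw {hw aw} => [//|x w] /=; rewrite rcons_path => /andP[].
- by move: aw; rewrite all_rcons => /andP[].
Qed.

Let config_walk (c : config D) := walk (map fst c.2) c.1.1.

Lemma config_walk_update c a : A a -> ~ is_counterfactual C Q c.1.1 ->
  config_walk c -> config_walk (update c a).
Proof.
move: c => [[s taken] v] Aa ns; rewrite /config_walk /= map_rcons.
exact: walk_step.
Qed.

Lemma config_walk_backtrack c c' :
  backtrack c c' -> config_walk c -> config_walk c'.
Proof. by case=> e0 v e; rewrite /config_walk /= map_rcons => /walk_pop. Qed.

Lemma make_consistent_walk c c' : make_consistent C A c c' ->
  config_walk c -> config_walk c' /\ causally_consistent C c'.1.1.
Proof.
move=> run wc; suff [wc' /contrapT] : config_walk c' /\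
  ~ ~ causally_consistent C c'.1.1 by [].
apply: while_loop_invariant run wc => {}c {}c' nc [a|a|{}c' _ _].
(* The guard [nc] says that the state violates a rule of [C], so it cannot be counterfactual. *)
- by case=> Aa _ _; apply: config_walk_update => // -[].
- by move=> _ [Aa _ _]; apply: config_walk_update => // -[].
- exact: config_walk_backtrack.
Qed.

Lemma get_path_walk r : causally_consistent C I -> get_path C Q A I r ->
  exists w s, [/\ map fst r = rcons w s, walk w s & is_counterfactual C Q s].
Proof.
move=> CI run.
(* Between iterations the current pair is the last entry of the list; splitting it off mirrors the
   pop and the final append of [intervene]. *)
pose P (v : seq (entry D)) := exists v' e, v = rcons v' e /\
  config_walk (e, v').
have [||] := while_loop_invariant _ _ _ P _ _ _ run.
- move=> v v' + vv'; case: vv' => v0 e c e' v1 mv mc.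
  rewrite last_rcons => nv [v2 [e2 [/rcons_inj[<- <-] we]]].
  exists v1, e'; split=> //.
  have [] // := make_consistent_walk _ _ mc.
  (* An action leaves a state that is not a goal, by the guard [nv] of [get_path]. *)
  case: mv => [a [Aa _]|c' _]; first exact: config_walk_update.
  by move=> /config_walk_backtrack; apply.
- by exists [::], (I, [::]); split.
move=> [v [e [-> we]]]; rewrite last_rcons => /contrapT ce.
by exists (map fst v), e.1; rewrite map_rcons.
Qed.

(** Both ends of the walk are consistent and survive the filter. The form ending in [s] yields the
    goal conditions, the form [I :: q] the start and the transitions. *)
Lemma candidate_path_solution (hI : causally_consistent C I) r :
  get_path C Q A I r ->
  solution_path (constructed_cfg Q A hI) (candidate_path C r).
Proof.
move=> /(get_path_walk _ hI)[w [s [rE [hw sw aw] cs]]].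
have [Cs nQs] := (is_counterfactualP s).1 cs.
have cE : candidate_path C r = rcons (filter consistent w) s.
  by rewrite /candidate_path -(filter_map fst consistent) rE filter_rcons
    /consistent; case: asboolP.
have [q [qE pq]] : exists q, candidate_path C r = I :: q /\ path transition I q.
  have cI : consistent I by apply/asboolP.
  have : candidate_path C r = filter consistent (rcons w s).
    by rewrite cE filter_rcons /consistent; case: asboolP.
  have : rcons w s <> [::] by case: (w).
  case: (rcons w s) hw sw => //= x p -> /path_filter_consistent[/(_ cI) pp _] _.
  by rewrite cI => ->; exists (filter consistent p).
(* Hence indices below [m] point into the filtered [w], and index [m] is [s]. *)
have sE : (size (candidate_path C r)).-1 = size (filter consistent w).
  by rewrite cE size_rcons.
split.
- by rewrite qE.
- by rewrite qE.
- by rewrite sE cE nth_rcons ltnn eqxx.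
- move=> j; rewrite sE cE -ltnS -(size_rcons _ s) => jm.
  have /(all_nthP I)/(_ j jm)/asboolP // : all consistent
    (rcons (filter consistent w) s).
  by rewrite all_rcons filter_all andbT; apply/asboolP.
- split=> [j|i]; last first.
    by rewrite qE => im; apply/asboolP; move/(pathP I): pq; apply.
  rewrite sE cE nth_rcons => jm; rewrite jm => /is_counterfactualP.
  have /(all_nthP I)/(_ j jm)/asboolP // : all nongoal (filter consistent w).
  by rewrite all_filter; apply: sub_all aw => x nx; apply/implyP.
Qed.

End Walks.

Theorem theorem1 (n : nat) (D : 'I_n -> Type)
    (C Q : set (rule D)) (A : set (state D -> state D)) (I : state D)
    (hI : causally_consistent C I) (hA : action_set C A)
    (r : seq (entry D)) (hr : get_path C Q A I r) :
  solution_path (constructed_cfg Q A hI) (candidate_path C r).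
Proof. exact: candidate_path_solution. Qed.
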